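(* Let $f:\operatorname{dom} f\subseteq\mathbb{R}^n\to\mathbb{R}$, let $x^0\in\operatorname{dom} f$, let $S=[s^1\ \cdots\ s^n]\in\mathbb{R}^{n\times n}$ have full rank, let $\ell\in\{0,1,\dots,n\}$, and let $\overline{T}=U_\ell$, where $U_0=S$ and, for $\ell\in\{1,\dots,n\}$, $$U_\ell=[\,s^1-s^\ell\ \cdots\ s^{\ell-1}-s^\ell\ \ -s^\ell\ \ s^{\ell+1}-s^\ell\ \cdots\ s^n-s^\ell\,]\in\mathbb{R}^{n\times n}.$$ Suppose $\mathcal{M}(x^0;S,\overline{T})\subset\operatorname{dom} f$. Then the Hessian $\mathbf{H}$ of the quadratic interpolation function $Q_f(x^0;S,\overline{T})$ of $f$ over $\mathcal{M}(x^0;S,\overline{T})$ is equal to the generalized simplex Hessian $\nabla_s^2 f(x^0;S,\overline{T})$.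
   Context: For $S=[s^1\cdots s^n]$ and $\overline{T}=U_\ell=[t^1\cdots t^n]$, the set of sample points is $$\mathcal{M}(x^0;S,\overline{T})=\{x^0\}\cup\{x^0+s^i\}_i\cup\{x^0+t^j\}_j\cup\{x^0+s^i+t^j\}_{i,j},\quad i,j\in\{1,\dots,n\}.$$ This set has exactly $(n+1)(n+2)/2$ points and is poised for quadratic interpolation: there is a unique quadratic function $Q_f(x^0;S,\overline{T})(x)=\alpha_0+\alpha^\top x+\frac12 x^\top\mathbf{H}x$ with $\alpha_0\in\mathbb{R}$, $\alpha\in\mathbb{R}^n$, $\mathbf{H}=\mathbf{H}^\top\in\mathbb{R}^{n\times n}$ that agrees with $f$ at every point of $\mathcal{M}(x^0;S,\overline{T})$; it is called the quadratic interpolation function of $f$ over $\mathcal{M}(x^0;S,\overline{T})$. $A^\dagger$ is the Moore–Penrose pseudoinverse of $A$. For $x\in\operatorname{dom} f$ and $T=[t^1\cdots t^k]\in\mathbb{R}^{n\times k}$, $\delta_s(x;T)\in\mathbb{R}^k$ has entries $f(x+t^j)-f(x)$, and $\nabla_s f(x;T)=(T^\top)^\dagger\delta_s(x;T)$. The generalized simplex Hessian is $\nabla_s^2 f(x^0;S,\overline{T})=(S^\top)^\dagger\,\delta_s^2(x^0;S,\overline{T})$, where $\delta_s^2(x^0;S,\overline{T})$ is the matrix whose $i$-th row is $(\nabla_s f(x^0+s^i;\overline{T})-\nabla_s f(x^0;\overline{T}))^\top$. *)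

(* Defs.v *)
From HB Require Import structures.
From mathcomp Require Import all_boot all_order all_algebra.
From mathcomp Require Import ring lra.
From mathcomp Require Import boolp classical_sets reals.

Set Implicit Arguments.
Unset Strict Implicit.
Unset Printing Implicit Defensive.

Import Order.TTheory GRing.Theory Num.Theory.

Local Open Scope classical_set_scope.
Local Open Scope ring_scope.

Section MoorePenrose.
Variable F : realFieldType.

(* The four Penrose equations; over the reals the adjoint is the transpose. *)
Definition penrose m n (A : 'M[F]_(m, n)) (B : 'M[F]_(n, m)) : bool :=
  [&& A *m B *m A == A, B *m A *m B == B,
      (A *m B)^T == A *m B & (B *m A)^T == B *m A].

Lemma gram_unitmx r n (B : 'M[F]_(r, n)) :
  row_free B -> B *m B^T \in unitmx.
Proof.
move=> fB; rewrite -row_free_unit; apply/inj_row_free => v vBB.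
have := congr1 (fun M : 'rV[F]_r => (M *m v^T) 0 0) vBB.
rewrite mul0mx [in RHS]mxE mulmxA -[_ *m v^T]mulmxA -trmx_mul mxE => /eqP.
rewrite psumr_eq0 => [/allP h|j _]; last by rewrite [_^T _ _]mxE -expr2 sqr_ge0.
apply/(row_free_inj fB); rewrite mul0mx; apply/rowP => j.
have /= := h j (mem_index_enum j).
by rewrite [_^T _ _]mxE mulf_eq0 orbb [in RHS]mxE => /eqP.
Qed.

Lemma penrose_exists m n (A : 'M[F]_(m, n)) : exists B, penrose A B.
Proof.
suff gen r (C : 'M[F]_(m, r)) (D : 'M[F]_(r, n)) :
    row_free C^T -> row_free D -> exists B, penrose (C *m D) B.
  have := gen _ (col_base A) (row_base A); rewrite mulmx_base; apply.
    by rewrite -row_leq_rank mxrank_tr col_leq_rank col_base_full.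
  exact: row_base_free.
move=> /gram_unitmx; rewrite trmxK => uC /gram_unitmx uD.
pose X := D^T *m invmx (D *m D^T); pose Y := invmx (C^T *m C) *m C^T.
have DX : D *m X = 1%:M by rewrite mulmxA mulmxV.
have YC : Y *m C = 1%:M by rewrite -mulmxA mulVmx.
exists (X *m Y).
have AB : C *m D *m (X *m Y) = C *m Y by rewrite -mulmxA (mulmxA D) DX mul1mx.
have BA : X *m Y *m (C *m D) = X *m D by rewrite -mulmxA (mulmxA Y) YC mul1mx.
rewrite /penrose AB BA; apply/and4P; split; apply/eqP.
- by rewrite -mulmxA (mulmxA Y) YC mul1mx.
- by rewrite -mulmxA (mulmxA D) DX mul1mx.
- by rewrite /Y !trmx_mul trmxK trmx_inv trmx_mul trmxK mulmxA.
- by rewrite /X !trmx_mul trmxK trmx_inv trmx_mul trmxK mulmxA.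
Qed.

Lemma penrose_unique m n (A : 'M[F]_(m, n)) (B C : 'M[F]_(n, m)) :
  penrose A B -> penrose A C -> B = C.
Proof.
move=> /and4P[/eqP b1 /eqP b2 /eqP b3 /eqP b4].
move=> /and4P[/eqP c1 /eqP c2 /eqP c3 /eqP c4].
have AB : A *m C = A *m B.
  have e : A *m C = A *m B *m (A *m C) by rewrite mulmxA b1.
  by rewrite e -[LHS]trmxK trmx_mul b3 c3 mulmxA c1 b3.
have BA : C *m A = B *m A.
  have e : C *m A = C *m A *m (B *m A) by rewrite -mulmxA (mulmxA A) b1.
  by rewrite e -[LHS]trmxK trmx_mul b4 c4 -mulmxA (mulmxA A) c1 b4.
by rewrite -b2 -BA -mulmxA -AB mulmxA c2.
Qed.

(* Not to be confused with mxalgebra's [pinvmx], which is only a one-sided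
   partial inverse and does not satisfy the Penrose symmetry equations. *)
Definition mpinv m n (A : 'M[F]_(m, n)) : 'M[F]_(n, m) :=
  xchoose (penrose_exists A).

Lemma mpinvP m n (A : 'M[F]_(m, n)) : penrose A (mpinv A).
Proof. exact: (xchooseP (penrose_exists A)). Qed.

End MoorePenrose.

Section SimplexDerivatives.
Variables (R : realType) (n : nat).
Implicit Types (f : 'cV[R]_n -> R) (x : 'cV[R]_n).

(* The directions are the columns of S and T.  A function on dom f is given by
   an arbitrary total extension; only its values at points of the form x,
   x + s^i, x + t^j and x + s^i + t^j are ever used. *)
Definition delta_s f x k (T : 'M[R]_(n, k)) : 'cV[R]_k :=
  \col_j (f (x + col j T) - f x).

Definition simplex_grad f x k (T : 'M[R]_(n, k)) : 'cV[R]_n :=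
  mpinv T^T *m delta_s f x T.

Definition delta2_s f x m k (S : 'M[R]_(n, m)) (T : 'M[R]_(n, k)) :
    'M[R]_(m, n) :=
  \matrix_(i < m)
    (simplex_grad f (x + col i S) T - simplex_grad f x T)^T.

Definition simplex_hess f x m k (S : 'M[R]_(n, m)) (T : 'M[R]_(n, k)) :
    'M[R]_n :=
  mpinv S^T *m delta2_s f x S T.

Definition sample_points x m k (S : 'M[R]_(n, m)) (T : 'M[R]_(n, k)) :
    set 'cV[R]_n :=
  [set x] `|` [set x + col i S | i in [set: 'I_m]]
  `|` [set x + col j T | j in [set: 'I_k]]
  `|` [set y | exists i j, y = x + col i S + col j T].

(* Columns are numbered from 0, so s^l with 1 <= l <= n is column l - 1; this
   is the k for which [unlift ord0 l = Some k], while [unlift ord0 l = None]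
   exactly when l = 0. *)
Definition Umx (S : 'M[R]_n) (l : 'I_n.+1) : 'M[R]_n :=
  if unlift ord0 l is Some k then
    \matrix_(i, j) (if j == k then - S i k else S i j - S i k)
  else S.

(* (alpha0, alpha, H) *)
Definition quadratic : Type := (R * 'cV[R]_n * 'M[R]_n)%type.

Definition quad_hess (q : quadratic) : 'M[R]_n := q.2.

Definition quad_eval (q : quadratic) x : R :=
  q.1.1 + (q.1.2^T *m x) 0 0 + 2^-1 * (x^T *m quad_hess q *m x) 0 0.

Definition quad_interpolates f (M : set 'cV[R]_n) (q : quadratic) : Prop :=
  (quad_hess q)^T = quad_hess q /\ forall y, M y -> quad_eval q y = f y.

(* The interpolant, when it exists and is unique (see [quad_interp_poised]);
   the zero quadratic if there is none. *)
Definition quad_interp f (M : set 'cV[R]_n) : quadratic :=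
  xget ((0, 0, 0) : quadratic) (quad_interpolates f M).

End SimplexDerivatives.

Section Poisedness.
Variables (R : realType) (n : nat).
Implicit Types (f : 'cV[R]_n -> R) (x y z : 'cV[R]_n) (H S : 'M[R]_n)
  (q : quadratic R n).

Definition bil H x y : R := (x^T *m H *m y) 0 0.

Lemma bilDl H x y z : bil H (x + y) z = bil H x z + bil H y z.
Proof. by rewrite /bil linearD !mulmxDl mxE. Qed.

Lemma bilDr H x y z : bil H z (x + y) = bil H z x + bil H z y.
Proof. by rewrite /bil mulmxDr mxE. Qed.

Lemma bilC H x y : H^T = H -> bil H x y = bil H y x.
Proof.
by move=> sH; rewrite -{1}sH /bil -{1}(trmxK y) -mulmxA -!trmx_mul mxE.
Qed.

Lemma col_mul m p k (A : 'M[R]_(m, p)) (B : 'M[R]_(p, k)) j :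
  col j (A *m B) = A *m col j B.
Proof. by rewrite !colE mulmxA. Qed.

Lemma bil_col S H i j : bil H (col i S) (col j S) = (S^T *m H *m S) i j.
Proof.
rewrite /bil tr_col -!row_mul -col_mul !mxE.
by apply: eq_bigr => k _; rewrite !mxE.
Qed.

Lemma lin_col S (a : 'cV[R]_n) i : (a^T *m col i S) 0 0 = (a^T *m S) 0 i.
Proof. by rewrite -col_mul mxE. Qed.

Lemma quad_evalD q x y : (quad_hess q)^T = quad_hess q ->
  quad_eval q (x + y) = quad_eval q x + (q.1.2^T *m y) 0 0
     + bil (quad_hess q) x y + 2^-1 * bil (quad_hess q) y y.
Proof.
move=> sH; rewrite /quad_eval mulmxDr [in LHS]mxE -!/(bil _ _ _).
by rewrite !(bilDl, bilDr) (bilC y x sH); field.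
Qed.

(* M(x0; S, U_l) = M(x0 - s^l; S, S) for l >= 1. *)
Lemma sample_points_shift x0 S l :
  sample_points x0 S (Umx S l) =
  let x := if unlift ord0 l is Some k then x0 - col k S else x0 in
  sample_points x S S.
Proof.
rewrite /Umx; case: (unlift ord0 l) => [k|] //=.
set U := \matrix_(i, j) _.
have Uk : col k U = - col k S.
  by apply/colP => i; rewrite !mxE eqxx.
have Uj j : j != k -> col j U = col j S - col k S.
  by move=> /negPf jk; apply/colP => i; rewrite !mxE jk.
apply/seteqP; split=> y /=.
  case=> [[[->|[i _ <-]]|[j _ <-]]|[i [j ->]]].
  - by left; left; right; exists k => //; rewrite ?subrK.
  - by right; exists k, i; rewrite subrK.
  - have [->|jk] := eqVneq j k; first by left; left; left; rewrite Uk.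
    by left; left; right; exists j => //; rewrite Uj // addrA addrAC.
  - have [->|jk] := eqVneq j k.
      by left; left; right; exists i => //; rewrite Uk addrAC.
    by right; exists i, j; apply/colP => a; rewrite Uj // !mxE; ring.
have base i : (exists j, x0 - col k S + col i S = x0 + col j U) \/ i = k.
  have [->|ik] := eqVneq i k; [by right|left].
  by exists i; rewrite Uj // addrA addrAC.
case=> [[[->|[i _ <-]]|[i _ <-]]|[i [j ->]]].
- by left; right; exists k => //; rewrite Uk.
- have [[j ->]|->] := base i; first by left; right; exists j.
  by left; left; left; rewrite subrK.
- have [[j ->]|->] := base i; first by left; right; exists j.
  by left; left; left; rewrite subrK.
have [[i' e]|->] := base j.
  by right; exists i, i'; rewrite addrAC e addrAC.
by left; left; right; exists i => //; rewrite addrAC subrK.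
Qed.

Lemma poised_uniq f x S q q' : S \in unitmx ->
  quad_interpolates f (sample_points x S S) q ->
  quad_interpolates f (sample_points x S S) q' -> q = q'.
Proof.
move=> uS [sq hq] [sq' hq'].
have e y : sample_points x S S y -> quad_eval q y = quad_eval q' y.
  by move=> My; rewrite hq ?hq'.
have e0 : quad_eval q x = quad_eval q' x by apply: e; left; left; left.
have e1 i := e (x + col i S) ltac:(by left; left; right; exists i).
have e2 i j := e (x + col i S + col j S) ltac:(by right; exists i, j).
have eH : quad_hess q = quad_hess q'.
  suff : S^T *m quad_hess q *m S = S^T *m quad_hess q' *m S.
    move=> /(can_inj (mulmxK uS)).
    by apply: (can_inj (mulKmx _)); rewrite unitmx_tr.
  apply/matrixP => i j; rewrite -!bil_col.
  have := e2 i j; have := e1 i; have := e1 j.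
  rewrite !quad_evalD // !(bilDl, bilDr).
  by move: e0; lra.
have ea : q.1.2 = q'.1.2.
  apply: (can_inj (@trmxK _ _ _)); apply: (can_inj (mulmxK uS)).
  apply/rowP => i; rewrite -!lin_col.
  by have := e1 i; rewrite !quad_evalD // eH e0; lra.
have ec : q.1.1 = q'.1.1.
  by move: e0; rewrite /quad_eval eH ea; lra.
case: q q' eH ea ec {sq hq sq' hq' e e0 e1 e2} => [[c a] H] [[c' a'] H'].
by rewrite /quad_hess /= => -> -> ->.
Qed.

Lemma poised_ex f x S : S \in unitmx ->
  exists q, quad_interpolates f (sample_points x S S) q.
Proof.
move=> uS.
pose d i := f (x + col i S) - f x.
pose h := \matrix_(i, j)
  (f (x + col i S + col j S) - f (x + col i S) - f (x + col j S) + f x).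
have sh : h^T = h.
  by apply/matrixP => i j; rewrite !mxE [x + _ + _]addrAC; ring.
pose H := (invmx S)^T *m h *m invmx S.
have sH : H^T = H by rewrite /H !trmx_mul trmxK sh mulmxA.
have SHS : S^T *m H *m S = h.
  by rewrite /H !mulmxA -trmx_mul mulVmx // trmx1 mul1mx mulmxKV.
pose g : 'rV_n := \row_i (d i - 2^-1 * h i i).
pose a : 'cV_n := (g *m invmx S)^T - H *m x.
pose q0 : quadratic R n := (0, a, H).
pose q : quadratic R n := (f x - quad_eval q0 x, a, H).
have ex : quad_eval q x = f x.
  by rewrite /quad_eval /q /= /q0 /quad_eval /=; ring.
have aS i : (a^T *m col i S) 0 0 = g 0 i - bil H x (col i S).
  rewrite /a linearB /= trmxK trmx_mul sH mulmxBl mxE [X in _ + X]mxE.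
  by rewrite -col_mul mulmxKV // [col _ _ _ _]mxE.
have bS i j : bil H (col i S) (col j S) = h i j by rewrite bil_col SHS.
have e1 i : quad_eval q (x + col i S) = f (x + col i S).
  by rewrite quad_evalD // ex aS bS [g _ _]mxE /d; lra.
exists q; split => // y.
case=> [[[->|[i _ <-]]|[i _ <-]]|[i [j ->]]] //.
by rewrite quad_evalD // e1 aS bilDl !bS !mxE /d; lra.
Qed.

Lemma quad_interp_poised f x0 S l : \rank S = n ->
  exists! q, quad_interpolates f (sample_points x0 S (Umx S l)) q.
Proof.
move=> rS.
have uS : S \in unitmx by rewrite -row_free_unit /row_free rS eqxx.
rewrite sample_points_shift /=; set x := (X in sample_points X).
have [q hq] := poised_ex f x uS.
by exists q; split=> [//|q' hq']; exact: (poised_uniq uS hq).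
Qed.

End Poisedness.

(* Main.v *)
(* A quadratic has constant second differences: for all directions s and t,
   Q(x + s + t) - Q(x + s) - Q(x + t) + Q(x) = s^T H t.  Taking the columns of
   S and of T = U_l, the interpolation conditions determine D := S^T H T.  Both
   S and T are invertible, so the pseudoinverses are inverses and the
   generalized simplex Hessian is S^-T D T^-1 = H. *)
Require Import Defs.
From HB Require Import structures.
From mathcomp Require Import all_boot all_order all_algebra.
From mathcomp Require Import ring.
From mathcomp Require Import boolp classical_sets reals.

Import Order.TTheory GRing.Theory Num.Theory.

Local Open Scope classical_set_scope.
Local Open Scope ring_scope.

Lemma mpinv_unitmx (F : realFieldType) (n : nat) (A : 'M[F]_n) :
  A \in unitmx -> mpinv A = invmx A.
Proof.
move=> uA; apply: (penrose_unique (mpinvP A)).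
by rewrite /penrose mulmxV // mulVmx // !mul1mx trmx1 !eqxx.
Qed.

(** Re-basing twice undoes itself: (s^j - s^l) - (-s^l) = s^j. This serves to get invertibility
    without a determinant. *)
Lemma UmxK (R : realType) (n : nat) (l : 'I_n.+1) :
  involutive (fun S : 'M[R]_n => Umx S l).
Proof.
move=> S; rewrite /Umx; case: (unlift ord0 l) => [k|] //.
apply/matrixP => i j; rewrite !mxE eqxx.
by case: (eqVneq j k) => [->|_]; ring.
Qed.

(** [Umx] is a column operation, hence a right multiplication by its effect on the identity. *)
Lemma Umx_mul1 (R : realType) (n : nat) (S : 'M[R]_n) (l : 'I_n.+1) :
  Umx S l = S *m Umx 1%:M l.
Proof.
rewrite /Umx; case: (unlift ord0 l) => [k|]; last by rewrite mulmx1.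
apply/matrixP => i j; rewrite -[S in LHS]mulmx1 !mxE.
case: eqP => [->|/eqP/negPf jk]; rewrite -?sumrB -?sumrN.
  by apply: eq_bigr => a _; rewrite !mxE eqxx mulrN.
by apply: eq_bigr => a _; rewrite !mxE jk mulrBr.
Qed.

Lemma unitmx_Umx (R : realType) (n : nat) (S : 'M[R]_n) (l : 'I_n.+1) :
  S \in unitmx -> Umx S l \in unitmx.
(* S = [Umx S l *m Umx 1%:M l], and both factors of an invertible product of square matrices are
   invertible. *)
Proof. by rewrite -{1}(UmxK R n l S) /= Umx_mul1 unitmx_mul => /andP[]. Qed.

Lemma bil_col2 (R : realType) (n m k : nat) (H : 'M[R]_n) (S : 'M[R]_(n, m))
    (T : 'M[R]_(n, k)) i j :
  bil H (col i S) (col j T) = (S^T *m H *m T) i j.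
Proof.
rewrite /bil tr_col -!row_mul -col_mul !mxE.
by apply: eq_bigr => a _; rewrite !mxE.
Qed.

Lemma quad_interp_interpolates (R : realType) (n : nat) (f : 'cV[R]_n -> R)
    (x0 : 'cV[R]_n) (S : 'M[R]_n) (l : 'I_n.+1) : \rank S = n ->
  quad_interpolates f (sample_points x0 S (Umx S l))
    (quad_interp f (sample_points x0 S (Umx S l))).
Proof.
move=> /(quad_interp_poised f x0 l)[q [hq _]].
(* Existence of an interpolant rules out the default zero quadratic of [xget]. *)
exact: (xgetPex _ (ex_intro _ q hq)).
Qed.

Lemma quad_interpolates_hess (R : realType) (n m k : nat) (f : 'cV[R]_n -> R)
    (x : 'cV[R]_n) (S : 'M[R]_(n, m)) (T : 'M[R]_(n, k)) (q : quadratic R n) :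
  quad_interpolates f (sample_points x S T) q ->
  S^T *m quad_hess q *m T =
    \matrix_i (delta_s f (x + col i S) T - delta_s f x T)^T.
Proof.
move=> [sq hq]; apply/matrixP => i j; rewrite -bil_col2 !mxE.
(* The second difference samples [f] only at x, x + t^j, x + s^i and x + s^i + t^j, where it agrees
   with [q]. *)
rewrite -!hq; last 4 first.
- by left; left; left.
- by left; right; exists j.
- by left; left; right; exists i.
- by right; exists i, j.
by rewrite !quad_evalD // bilDl; ring.
Qed.

(** Each simplex gradient is T^-T times a difference vector; transposed into rows, all share the
    right factor T^-1. *)
Lemma delta2_s_unitmx (R : realType) (n m : nat) (f : 'cV[R]_n -> R)
    (x : 'cV[R]_n) (S : 'M[R]_(n, m)) (T : 'M[R]_n) : T \in unitmx ->
  delta2_s f x S T =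
    (\matrix_i (delta_s f (x + col i S) T - delta_s f x T)^T) *m invmx T.
Proof.
move=> uT; apply/row_matrixP => i; rewrite row_mul !rowK /simplex_grad.
by rewrite mpinv_unitmx ?unitmx_tr // -mulmxBr trmx_mul trmx_inv trmxK.
Qed.

Theorem mainTheorem5 (R : realType) (n : nat) (domf : set 'cV[R]_n)
    (f : 'cV[R]_n -> R) (x0 : 'cV[R]_n) (S : 'M[R]_n) (l : 'I_n.+1) :
  domf x0 ->
  \rank S = n ->
  sample_points x0 S (Umx S l) `<=` domf ->
  quad_hess (quad_interp f (sample_points x0 S (Umx S l))) =
    simplex_hess f x0 S (Umx S l).
Proof.
move=> _ rS _.
have uS : S \in unitmx by rewrite -row_free_unit /row_free rS eqxx.
have uT := unitmx_Umx _ _ S l uS.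
have /quad_interpolates_hess hH := quad_interp_interpolates R n f x0 S l rS.
rewrite /simplex_hess delta2_s_unitmx // -hH mulmxK //.
by rewrite mpinv_unitmx ?unitmx_tr // mulKmx ?unitmx_tr.
Qed.
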